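(* Let $X$ be a connected CW complex whose fundamental group $\pi=\pi_1(X)$ is finite, and let $q\colon\widetilde X\to X$ be its universal cover. Then $$\mathrm{dcat}_1(X)\le|\pi|-1,$$ and a section $\tau\colon X\to\widetilde X_{|\pi|}$ of $q_{|\pi|}\colon\widetilde X_{|\pi|}\to X$ is given by $$\tau(x)=\frac1{|\pi|}\widetilde x_1+\cdots+\frac1{|\pi|}\widetilde x_{|\pi|},\qquad\text{where }\{\widetilde x_1,\ldots,\widetilde x_{|\pi|}\}=q^{-1}(x).$$
   Context: All spaces are connected CW complexes and maps are continuous. For a space $Z$ and an integer $n\ge 1$, let $\mathcal B_n(Z)$ be the set of probability measures on $Z$ supported on at most $n$ points, i.e. formal sums $\sum_{i=1}^n a_i z_i$ with $z_i\in Z$, $a_i\ge 0$, $\sum a_i=1$ (a point $z$ standing for the Dirac measure $\delta_z$). It carries the topology of weak convergence of measures; for metric $Z$ this is the topology of the Lévy–Prokhorov metric. For a map $f\colon E\to B$ put $E_n=\{\mu\in\mathcal B_n(E)\mid \mathrm{supp}(\mu)\subset f^{-1}(b)\text{ for some } b\in B\}$, a subspace of $\mathcal B_n(E)$, and let $f_n\colon E_n\to B$ send $\mu$ to that $b$. If $f$ is a fibration, then so is $f_n$. The distributional one-category $\mathrm{dcat}_1(X)$ is the least integer $n\ge 0$ such that $q^X_{n+1}\colon \widetilde X_{n+1}\to X$ has a section, where $q^X\colon\widetilde X\to X$ is the universal covering ($\infty$ if no such $n$ exists). *)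

(* Defs.v *)
From HB Require Import structures.
From mathcomp Require Import all_boot all_order all_algebra finmap.
From mathcomp Require Import all_classical all_reals all_analysis homotopy.

Set Implicit Arguments.
Unset Strict Implicit.
Unset Printing Implicit Defensive.

Import Order.TTheory GRing.Theory Num.Theory.
Import numFieldNormedType.Exports.

Local Open Scope classical_set_scope.
Local Open Scope ring_scope.

Definition homeo_on (S T : topologicalType) (A : set S) (B : set T)
    (f : S -> T) : Prop :=
  exists g : T -> S,
    [/\ {within A, continuous f}, {within B, continuous g},
        f @` A `<=` B, g @` B `<=` A &
        {in A, cancel f g} /\ {in B, cancel g f}].

Definition disc (R : realType) (n : nat) : set 'rV[R]_n :=
  [set v | \sum_(i < n) v ord0 i ^+ 2 <= 1].

Definition open_disc (R : realType) (n : nat) : set 'rV[R]_n :=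
  [set v | \sum_(i < n) v ord0 i ^+ 2 < 1].

Definition sphere (R : realType) (n : nat) : set 'rV[R]_n :=
  [set v | \sum_(i < n) v ord0 i ^+ 2 = 1].

Arguments disc : clear implicits.
Arguments open_disc : clear implicits.
Arguments sphere : clear implicits.

(* [CW_char i] is the characteristic map of the cell [i], of dimension
   [CW_dim i]; only its values on the closed disc matter. The last two fields are
   closure-finiteness and the weak topology. *)
Record CW_complex (R : realType) (X : topologicalType) : Type := CWComplex {
  CW_hausdorff : hausdorff_space X ;
  CW_cell : Type ;
  CW_dim : CW_cell -> nat ;
  CW_char : forall i : CW_cell, 'rV[R]_(CW_dim i) -> X ;
  CW_char_continuous : forall i,
    {within disc R (CW_dim i), continuous (@CW_char i)} ;
  CW_char_homeo : forall i,
    homeo_on (open_disc R (CW_dim i)) (@CW_char i @` open_disc R (CW_dim i))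
      (@CW_char i) ;
  CW_disjoint : trivIset setT (fun i => @CW_char i @` open_disc R (CW_dim i)) ;
  CW_cover : \bigcup_i (@CW_char i @` open_disc R (CW_dim i)) = setT ;
  CW_closure_finite : forall i, exists J : set CW_cell,
    [/\ finite_set J, (forall j, J j -> (CW_dim j < CW_dim i)%N) &
        @CW_char i @` sphere R (CW_dim i) `<=`
          \bigcup_(j in J) (@CW_char j @` open_disc R (CW_dim j))] ;
  CW_weak_topology : forall A : set X,
    closed A <-> forall i, closed (disc R (CW_dim i) `&` @CW_char i @^-1` A)
}.

Definition unit_interval (R : realType) : Type := `[0 : R, 1]%classic.

HB.instance Definition _ (R : realType) := Topological.on (unit_interval R).

Section unit_interval_bipointed.
Context (R : realType).

Let mem0 : (0 : R) \in (`[0 : R, 1]%classic : set R).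
Proof. by rewrite inE/= in_itv/= lexx ler01. Qed.

Let mem1 : (1 : R) \in (`[0 : R, 1]%classic : set R).
Proof. by rewrite inE/= in_itv/= lexx ler01. Qed.

Definition unit_interval0 : unit_interval R := exist _ 0 mem0.
Definition unit_interval1 : unit_interval R := exist _ 1 mem1.

Let unit_interval01 : unit_interval0 != unit_interval1.
Proof. by apply/eqP => /(congr1 sval)/= /esym/eqP; rewrite oner_eq0. Qed.

HB.instance Definition _ :=
  isBiPointed.Build (unit_interval R) unit_interval01.

End unit_interval_bipointed.

Definition path_homotopic (R : realType) (X : topologicalType) (x y : X)
    (f g : {path unit_interval R from x to y in X}) : Prop :=
  exists H : unit_interval R * unit_interval R -> X,
    [/\ continuous H,
        forall t, H (zero, t) = f t, forall t, H (one, t) = g t,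
        forall s, H (s, zero) = x & forall s, H (s, one) = y].

(* The underlying set of the fundamental group: the set of path-homotopy
   classes of loops. *)
Definition pi1 (R : realType) (X : topologicalType) (x : X)
    : set (set {path unit_interval R from x to x in X}) :=
  range (fun f => [set g | path_homotopic f g]).

Arguments pi1 R {X} x.

Definition pi1_order (R : realType) (X : topologicalType) (x : X) : nat :=
  #|` fset_set (pi1 R x)|%fset.

Definition simply_connected (R : realType) (X : topologicalType) : Prop :=
  (forall x y : X, inhabited {path unit_interval R from x to y in X}) /\
  (forall (x : X) (f : {path unit_interval R from x to x in X}),
     path_homotopic f (cst x)).

Definition evenly_covered (E B : topologicalType) (p : E -> B) (U : set B)
    : Prop :=
  exists (I : Type) (V : I -> set E),
    [/\ forall i, open (V i), trivIset setT V, p @^-1` U = \bigcup_i V i &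
        forall i, homeo_on (V i) U p].

Definition covering_map (E B : topologicalType) (p : E -> B) : Prop :=
  [/\ continuous p, range p = setT &
      forall b : B, exists U, [/\ open U, U b & evenly_covered p U]].

(* [E] is required to be nonempty by its pointed structure. *)
Definition universal_covering (R : realType) (E : ptopologicalType)
    (B : topologicalType) (p : E -> B) : Prop :=
  covering_map p /\ simply_connected R E.

Definition has_section (E B : topologicalType) (p : E -> B) : Prop :=
  exists s : B -> E, continuous s /\ forall b, p (s b) = b.

Definition borel (Z : ptopologicalType) := g_sigma_algebraType (@open Z).

HB.instance Definition _ (Z : ptopologicalType) := Measurable.on (borel Z).

Definition borel_prob (R : realType) (Z : ptopologicalType) : Type :=
  probability (borel Z) R.

HB.instance Definition _ (R : realType) (Z : ptopologicalType) :=
  Choice.on (borel_prob R Z).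

Definition bounded_continuous (R : realType) (Z : topologicalType) : Type :=
  {f : Z -> R | continuous f /\ bounded_fun f}.

Definition integrals (R : realType) (Z : ptopologicalType)
    (mu : borel_prob R Z) : {ptws bounded_continuous R Z -> R} :=
  fun f => Rintegral mu setT (sval f).

(* The topology of weak convergence: the coarsest one for which integration of
   every bounded continuous function is continuous. *)
HB.instance Definition _ (R : realType) (Z : ptopologicalType) :=
  Topological.copy (borel_prob R Z) (initial_topology (@integrals R Z)).

(* The equality is required on all subsets of [Z], not only the Borel ones,
   since the values of a [probability] on non-measurable sets are otherwise
   arbitrary and one measure would have several representatives. *)
Definition is_sum_of_diracs (R : realType) (Z : ptopologicalType) (n : nat)
    (mu : borel_prob R Z) (a : 'I_n -> R) (z : 'I_n -> Z) : Prop :=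
  forall A : set Z,
    mu A = (\sum_(i < n) (a i)%:E * \d_(z i : borel Z) A)%E.

Definition finprob (R : realType) (n : nat) (Z : ptopologicalType)
    : set (borel_prob R Z) :=
  [set mu | exists (a : 'I_n -> R) (z : 'I_n -> Z),
    [/\ forall i, 0 <= a i, \sum_(i < n) a i = 1 & is_sum_of_diracs mu a z]].

Definition supp (R : realType) (Z : ptopologicalType) (mu : borel_prob R Z)
    : set Z :=
  [set z | forall U : set Z, open U -> U z -> (0 < mu U)%E].

Section fiberwise.
Context (R : realType) (E : ptopologicalType) (B : topologicalType).
Variables (f : E -> B) (n : nat).

(* $E_n$, with its subspace topology *)
Definition fiberwise_prob : set (borel_prob R E) :=
  [set mu | finprob n mu /\ exists b, supp mu `<=` f @^-1` [set b]].

(* $f_n$ *)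
Definition fiberwise_proj (mu : fiberwise_prob) : B :=
  sval (cid (set_valP mu).2).

End fiberwise.

Arguments fiberwise_prob R {E B} f n.

(* $dcat_1(X)$ when [q] is a universal covering of [X]; these are unique up to
   isomorphism over [X], so the value does not depend on the choice of [q]. *)
Definition dcat1 (R : realType) (E : ptopologicalType) (X : topologicalType)
    (q : E -> X) : \bar R :=
  let P n := `[< has_section (@fiberwise_proj R E X q n.+1) >] in
  if pselect (exists n, P n) is left ex then (ex_minn ex)%:R%:E else +oo%E.

(* Main.v *)
(* Lifting loops at x0 and recording the endpoint of the lift identifies
   pi_1(X, x0) with the fiber q^-1(x0), so that this fiber has |pi| points; since
   the number of sheets is locally constant and X is connected, all fibers do.
   The uniform measure on the fiber over x is supported exactly on that fiber,
   which is closed as X is Hausdorff. Over an evenly covered neighbourhood of x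
   it is the average of the Dirac measures at |pi| continuous local sections of
   q, so the integral of a bounded continuous function against it is continuous
   in x. *)
Require Import Defs.
From HB Require Import structures.
From mathcomp Require Import all_boot all_order all_algebra finmap.
From mathcomp Require Import all_classical all_reals all_analysis homotopy.
From mathcomp Require Import measurable_realfun ring lra.

Set Implicit Arguments.
Unset Strict Implicit.
Unset Printing Implicit Defensive.

Import Order.TTheory GRing.Theory Num.Theory.
Import numFieldNormedType.Exports.

Local Open Scope classical_set_scope.
Local Open Scope ring_scope.

(** * Connectedness and locally constant properties *)

Lemma connected_locally_constant (T : topologicalType) (A : set T)
    (P : T -> Prop) : connected A ->
  (forall t, A t -> \forall t' \near t, A t' -> (P t' <-> P t)) ->
  forall t0 t1, A t0 -> A t1 -> P t0 -> P t1.
Proof.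
move=> cA lP t0 t1 At0 At1 Pt0.
(* Each of [P] and its negation persists on [A] near the points of [A] where it holds, so the
   interior of its [nbr] is an open set of [T] that cuts it out of [A]. The truth set of [P] is thus
   open and closed relative to [A]. *)
pose nbr Q : set T := [set t | \forall t' \near t, A t' -> Q t'].
suff : A `&` P = A by move/seteqP => [_ /(_ _ At1)[]].
have nbrE Q : (forall t, A t -> Q t -> nbr Q t) -> A `&` Q = A `&` (nbr Q)°.
  move=> nQ; apply/seteqP; split => t [At Qt]; split => //.
    have := nQ _ At Qt; rewrite /nbr/= => /nbhs_interior.
    by apply: filterS => t'; exact.
  by apply: (nbhs_singleton (nbhs_singleton Qt)).
apply: cA; first by exists t0.
- exists (nbr P)°; first exact: open_interior.
  by apply: nbrE => t At Pt; apply: filterS (lP _ At) => t' /[apply] ->.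
- exists (~` (nbr (~` P))°); first exact/open_closedC/open_interior.
  have : A `&` ~` P = A `&` (nbr (~` P))°.
    apply: nbrE => t At Pt; apply: filterS (lP _ At) => t' /[apply] tt'.
    by move/tt'.
  move=> /seteqP[h1 h2]; apply/seteqP; split => t [At Pt]; split => //.
    by move=> nt; have [] := h2 t (conj At nt).
  by apply: contrapT => nPt; have [] := h1 t (conj At nPt).
Qed.

(** * Evenly covered sets and uniqueness of lifts *)

(** An even covering with the inverse homeomorphisms chosen as data. They are local sections of [p],
    continuous at the points of [U] in the ambient sense rather than within [U], which is legitimate
    for open [U]. *)
Record sheets (E B : topologicalType) (p : E -> B) (U : set B) := Sheets {
  sheet_index : Type ;
  sheet : sheet_index -> set E ;
  sheet_section : sheet_index -> B -> E ;
  sheet_open : forall i, open (sheet i) ;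
  sheet_inj : forall i j e, sheet i e -> sheet j e -> i = j ;
  sheet_cover : forall e, U (p e) -> exists i, sheet i e ;
  sheet_section_in : forall i b, U b -> sheet i (sheet_section i b) ;
  sheet_sectionK : forall i b, U b -> p (sheet_section i b) = b ;
  sheetK : forall i e, sheet i e -> sheet_section i (p e) = e ;
  sheet_section_continuous : forall i b, U b ->
    {for b, continuous (sheet_section i)}
}.

Arguments sheet {E B p U} s i.
Arguments sheet_section {E B p U} s i.
Arguments sheet_cover {E B p U} s {e}.
Arguments sheet_section_in {E B p U} s i {b}.
Arguments sheet_sectionK {E B p U} s i {b}.
Arguments sheet_section_continuous {E B p U} s i {b}.

Lemma covering_sheets (E B : topologicalType) (p : E -> B) (b : B) :
  covering_map p -> exists U, [/\ open U, U b & inhabited (sheets p U)].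
Proof.
move=> [_ _ /(_ b)[U [oU Ub [I [V [oV tV pV hV]]]]]].
exists U; split => //.
have /choice[g gP] := hV.
constructor; apply: (@Sheets E B p U I V g) => //.
- by move=> i j e Vi Vj; apply: tV => //; exists e.
- move=> e Upe; have : (p @^-1` U) e by [].
  by rewrite pV => -[i _ Vie]; exists i.
- move=> i x Ux; have [_ _ _ gUV _] := gP i.
  by apply: gUV; exists x.
- move=> i x Ux; have [_ _ _ _ [_ gK]] := gP i.
  by apply: gK; rewrite inE.
- move=> i e Vie; have [_ _ _ _ [gK _]] := gP i.
  by apply: gK; rewrite inE.
- move=> i x Ux; have [_ + _ _ _] := gP i.
  rewrite continuous_open_subspace// => cg.
  by apply: cg; rewrite inE.
Qed.

Section covering.
Context {E B : topologicalType} {p : E -> B} (covp : covering_map p).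

(** Sheets are open and pairwise disjoint, so the sheet containing [f t] is locally constant in
    [t]. *)
Lemma sheet_connected {T : topologicalType} {A : set T} {f : T -> E}
    {U : set B} (S : sheets p U) (i : sheet_index S) :
  connected A -> (forall t, A t -> U (p (f t))) ->
  (forall t, A t -> {for t, continuous f}) ->
  forall t0 t1, A t0 -> A t1 -> sheet S i (f t0) -> sheet S i (f t1).
Proof.
move=> cA AU cf; apply: connected_locally_constant => // t At.
have [j Vj] := sheet_cover S (AU _ At).
have : \forall t' \near t, sheet S j (f t').
  by apply: cf => //; apply: open_nbhs_nbhs; split => //; exact: sheet_open.
apply: filterS => t' Vj' At'; split => Vi.
  by rewrite (sheet_inj Vi Vj').
by rewrite (sheet_inj Vi Vj).
Qed.

(** Agreement is locally constant: near [t] each of [f] and [g] stays in one sheet, and since a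
    sheet has a single point over each point of the base, they agree exactly when the two sheets
    coincide. *)
Lemma lift_unique (T : topologicalType) (f g : T -> E) (t0 : T) :
  connected [set: T] -> continuous f -> continuous g ->
  (forall t, p (f t) = p (g t)) -> f t0 = g t0 -> forall t, f t = g t.
Proof.
move=> cT cf cg pfg fg0 t.
apply: (@connected_locally_constant _ setT (fun t => f t = g t) cT _ t0) => //.
move=> {}t _; have [U [oU Ub [S]]] := covering_sheets (p (f t)) covp.
have [i Vi] := sheet_cover S Ub.
have [j Vj] : exists j, sheet S j (g t) by apply: sheet_cover; rewrite -pfg.
have ni : \forall t' \near t, sheet S i (f t').
  by apply: cf; apply: open_nbhs_nbhs; split => //; exact: sheet_open.
have nj : \forall t' \near t, sheet S j (g t').
  by apply: cg; apply: open_nbhs_nbhs; split => //; exact: sheet_open.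
near=> t' => _.
have Vi' : sheet S i (f t') by near: t'.
have Vj' : sheet S j (g t') by near: t'.
split => fg.
- have ij : i = j by apply: (sheet_inj Vi'); rewrite fg.
  by rewrite -(sheetK Vi) pfg ij (sheetK Vj).
- have ij : i = j by apply: (sheet_inj Vi); rewrite fg.
  by rewrite -(sheetK Vi') pfg ij (sheetK Vj').
Unshelve. all: by end_near. Qed.

End covering.

(** * The unit interval as a retract of the real line *)

Section clamp.
Context {R : realType}.
Local Notation I := (unit_interval R).

Lemma clamp_subproof (t : R) : Num.max 0 (Num.min t 1) \in `[0 : R, 1]%classic.
Proof.
rewrite inE/= in_itv/= le_max lexx/= ge_max ler01/=.
by rewrite ge_min lexx orbT.
Qed.

(** Precomposition with this retraction extends a path to the whole line, where pasting and
    reparametrization need no membership proofs. *)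
Definition clamp (t : R) : I := exist _ (Num.max 0 (Num.min t 1)) (clamp_subproof t).

Lemma continuous_clampR (a b : R) :
  continuous (fun t : R => Num.max a (Num.min t b)).
Proof.
move=> t; apply: (@continuous_max _ R (cst a) (fun t => Num.min t b)).
  exact: cst_continuous.
apply: (@continuous_min _ R id (cst b)); [exact: cvg_id|exact: cst_continuous].
Qed.

Lemma continuous_clamp : continuous clamp.
Proof. by apply: continuous_comp_initial; exact: continuous_clampR. Qed.

Lemma continuous_uval : continuous (fun t : I => sval t : R).
Proof. exact: initial_continuous. Qed.

Lemma uval_itv (t : I) : 0 <= sval t <= 1.
Proof. by case: t => t /= /[1!inE]/=; rewrite in_itv. Qed.

Lemma clampK (t : I) : clamp (sval t) = t.
Proof.
apply/val_inj => /=; have /andP[t0 t1] := uval_itv t.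
by rewrite min_l// max_r.
Qed.

Lemma clamp_le0 (t : R) : t <= 0 -> clamp t = zero.
Proof.
move=> t0; apply/val_inj => /=.
by rewrite min_l ?max_l//; apply: (le_trans t0).
Qed.

Lemma clamp_ge1 (t : R) : 1 <= t -> clamp t = one.
Proof. by move=> t1; apply/val_inj => /=; rewrite min_r// max_r. Qed.

Lemma clampE (t : R) : 0 <= t <= 1 -> sval (clamp t) = t.
Proof. by move=> /andP[t0 t1] /=; rewrite min_l// max_r. Qed.

Lemma connected_unit_interval : connected [set: I].
Proof.
have -> : [set: I] = clamp @` setT.
  by apply/seteqP; split => // t _; exists (sval t) => //; rewrite clampK.
apply: connected_continuous_connected.
  by apply/connected_intervalP.
by apply: continuous_subspaceT; exact: continuous_clamp.
Qed.

Lemma continuous_paste (Y : topologicalType) (f g : R -> Y) (a : R) :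
  continuous f -> continuous g -> f a = g a ->
  continuous (fun t => if t <= a then f t else g t).
Proof.
move=> cf cg fga; apply/continuous_subspace_setT.
have -> : [set: R] = [set t | t <= a] `|` [set t | a <= t].
  by apply/seteqP; split => // t _ /=; apply/orP/le_total.
apply: withinU_continuous.
- exact: closed_le.
- exact: closed_ge.
- apply: (@subspace_eq_continuous _ _ _ f); last exact: continuous_subspaceT.
  by move=> t; rewrite inE/= => ta; rewrite /from_subspace; case: ifPn => // /negP[].
- apply: (@subspace_eq_continuous _ _ _ g); last exact: continuous_subspaceT.
  move=> t; rewrite inE/= => at_; rewrite /from_subspace; case: ifPn => // ta.
  by have -> : t = a by apply/eqP; rewrite eq_le ta.
Qed.

End clamp.

Arguments clamp {R} t : simpl never.

(** * Lifting of paths and homotopies *)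

Lemma continuous_funcomp (S T U : topologicalType) (f : S -> T) (g : T -> U) :
  continuous f -> continuous g -> continuous (fun s => g (f s)).
Proof. by move=> cf cg s; apply: continuous_comp; [exact: cf|exact: cg]. Qed.

Lemma continuous_pairl (S T : topologicalType) (y : T) :
  continuous ((fun s => (s, y)) : S -> (S * T)%type).
Proof. by move=> s; apply: cvg_pair; [exact: cvg_id|exact: cvg_cst]. Qed.

Lemma continuous_pairr (S T : topologicalType) (x : S) :
  continuous ((fun t => (x, t)) : T -> (S * T)%type).
Proof. by move=> t; apply: cvg_pair; [exact: cvg_cst|exact: cvg_id]. Qed.

Lemma continuous_pair (S T1 T2 : topologicalType) (f : S -> T1) (g : S -> T2) :
  continuous f -> continuous g ->
  continuous ((fun s => (f s, g s)) : S -> (T1 * T2)%type).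
Proof. by move=> cf cg s; apply: cvg_pair; [exact: cf|exact: cg]. Qed.

Section path_lifting.
Context {R : realType} {E B : topologicalType} {p : E -> B}.
Hypothesis covp : covering_map p.
Local Notation I := (unit_interval R).

(** When [c] maps [x, y] into an evenly covered set, a lift over [0, x] continues over [0, y] by the
    section of the sheet containing its value at x. Liftability over [0, s] is therefore locally
    constant in s. *)
Lemma line_lift (c : R -> B) (e0 : E) : continuous c -> p e0 = c 0 ->
  exists g : R -> E, [/\ continuous g, g 0 = e0 &
    forall t, 0 <= t <= 1 -> p (g t) = c t].
Proof.
move=> cc pe0.
pose Q (s : R) := exists g : R -> E, [/\ continuous g, g 0 = e0 &
    forall t, 0 <= t <= s -> p (g t) = c t].
have Qstep (U : set B) (S : sheets p U) (x y : R) : 0 <= x ->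
    (forall t, x <= t <= y -> U (c t)) -> Q x -> Q y.
  move=> x0 Uxy [g [cg g0 pg]].
  have [yx|xy] := leP y x.
    exists g; split => // t /andP[t0 ty]; apply: pg.
    by rewrite t0 (le_trans ty yx).
  have Uc t : U (c (Num.max x (Num.min t y))).
    by apply: Uxy; rewrite le_max lexx/= ge_max (ltW xy)/= ge_min lexx orbT.
  have Uk : U (c x) by apply: Uxy; rewrite lexx ltW.
  have pgx : p (g x) = c x by apply: pg; rewrite x0 lexx.
  have [i Vi] : exists i, sheet S i (g x) by apply: sheet_cover; rewrite pgx.
  (* The argument is clamped to [x, y], outside which [c] may leave [U] and the section need not be
     continuous. *)
  pose h t := sheet_section S i (c (Num.max x (Num.min t y))).
  exists (fun t => if t <= x then g t else h t); split.
  - apply: continuous_paste => //.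
      move=> t; apply: (@continuous_comp _ _ _
        (fun t => c (Num.max x (Num.min t y))) (sheet_section S i)).
        apply: (@continuous_comp _ _ _ (fun t => Num.max x (Num.min t y)) c).
          exact: continuous_clampR.
        exact: cc.
      exact: sheet_section_continuous.
    by rewrite /h min_l ?ltW// maxxx -pgx sheetK.
  - by rewrite x0.
  - move=> t /andP[t0 ty]; case: ifPn => [tx|]; first by rewrite pg// t0.
    rewrite -ltNge => xt; rewrite /h sheet_sectionK//.
    by rewrite min_l// max_r// ltW.
(* Indexing by the absolute value lets the connected set be the whole line while the endpoints stay
   nonnegative, as [Qstep] requires. *)
suff : Q `|1| by rewrite normr1.
apply: (@connected_locally_constant R setT (fun t => Q `|t|) _ _ 0) => //.
- exact/connected_intervalP.
- move=> t _; have [U [oU Ub [S]]] := covering_sheets (c `|t|) covp.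
  have : \forall u \near `|t|, U (c u).
    by apply: cc; apply: open_nbhs_nbhs.
  move=> /nbhs_ballP[e e_gt0 eU].
  have nt : \forall u \near t, ball `|t| e `|u|.
    near=> u; rewrite /ball/=; apply: (le_lt_trans (ler_dist_dist _ _)).
    near: u; exact: nbhsx_ballx.
  have bt : ball `|t| e `|t| by exact: ballxx.
  have step x y : ball `|t| e x -> ball `|t| e y -> 0 <= x -> Q x -> Q y.
    rewrite /ball/= !ltr_distl => /andP[x1 x2] /andP[y1 y2] x0.
    apply: (@Qstep U S) => // u /andP[xu uy]; apply: eU.
    by rewrite /ball/= ltr_distl; apply/andP; split; lra.
  by apply: filterS nt => u bu _; split; apply: step.
- exists (cst e0); split => //; first exact: cst_continuous.
  move=> t; rewrite normr0 => t0; have -> // : t = 0.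
  by apply/eqP; rewrite eq_le andbC.
Unshelve. all: by end_near. Qed.

Lemma interval_lift (c : I -> B) (e0 : E) : continuous c -> p e0 = c zero ->
  exists g : I -> E, [/\ continuous g, g zero = e0 & forall t, p (g t) = c t].
Proof.
move=> cc pe0.
have [||g [cg g0 pg]] := @line_lift (c \o clamp) e0 _ _.
- by move=> t; apply: continuous_comp; [exact: continuous_clamp|exact: cc].
- by rewrite /= clamp_le0.
- exists (fun t => g (sval t)); split => //.
  + move=> t; apply: (@continuous_comp _ _ _ (fun t : I => sval t : R) g).
      exact: continuous_uval.
    exact: cg.
  + by move=> t; rewrite pg ?uval_itv//= clampK.
Qed.

(* For fixed [s0], the times [t] at which [L s t] is continuous in [s] at [s0]
   form a clopen subset of the interval: over a short time interval around [t]
   the lifts [L s] with [s] close to [s0] each stay in a single sheet. *)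
Lemma lift_continuous_parameter (S : topologicalType) (H : S * I -> B)
    (L : S -> I -> E) :
  continuous H -> (forall s, continuous (L s)) ->
  (forall s t, p (L s t) = H (s, t)) -> continuous (L^~ zero) ->
  forall t, continuous (L^~ t).
Proof.
move=> cH cL pL cL0 t s0.
apply: (@connected_locally_constant _ setT (fun t => {for s0, continuous (L^~ t)})
  (@connected_unit_interval R) _ zero) => //; last exact: cL0.
move=> {}t _; have [U [oU Ub [Sh]]] := covering_sheets (H (s0, t)) covp.
have : \forall z \near (s0, t), U (H z).
  by apply: cH; apply: open_nbhs_nbhs.
move=> [[N J]/= [nN nJ] NJU].
have : \forall u \near (sval t : R), J (clamp u).
  by apply: continuous_clamp; rewrite clampK.
move=> /nbhs_ballP[e e_gt0 eJ].
have nt : \forall u \near t, ball (sval t : R) e (sval u).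
  by apply: continuous_uval; exact: nbhsx_ballx.
have step (x y : I) : ball (sval t : R) e (sval x) -> ball (sval t : R) e (sval y) ->
    {for s0, continuous (L^~ x)} -> {for s0, continuous (L^~ y)}.
  move=> bx by_ cx.
  have HU s u : N s -> ball (sval t : R) e u -> U (H (s, clamp u)).
    by move=> Ns bu; apply: NJU; split => //=; exact: eJ.
  have NHU s (u : I) : N s -> ball (sval t : R) e (sval u) -> U (H (s, u)).
    by move=> Ns bu; rewrite -(clampK u); exact: HU.
  have Ns0 := nbhs_singleton nN.
  have [i Vi] : exists i, sheet Sh i (L s0 x).
    by apply: sheet_cover; rewrite pL; exact: NHU.
  have nV : \forall s \near s0, sheet Sh i (L s x).
    by apply: cx; apply: open_nbhs_nbhs; split => //; exact: sheet_open.
  (* For s near s0 the lift at time [y] is the section of one fixed sheet applied to [H (s, y)],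
     which is continuous in s. *)
  have LE s : N s -> sheet Sh i (L s x) ->
      L s y = sheet_section Sh i (H (s, y)).
    move=> Ns Vs; rewrite -pL sheetK//.
    rewrite -(clampK y); rewrite -(clampK x) in Vs.
    apply: (@sheet_connected _ _ _ R (ball (sval t : R) e)
      (fun u => L s (clamp u)) U Sh i _ _ _ _ _ bx by_ Vs).
    - apply/connected_intervalP => u v.
      rewrite /ball/= !ltr_distl => /andP[? ?] /andP[? ?] w /andP[? ?].
      by rewrite /= ltr_distl; apply/andP; split; lra.
    - by move=> u bu; rewrite pL; exact: HU.
    - move=> u _; apply: (@continuous_comp _ _ _ clamp (L s)).
        exact: continuous_clamp.
      exact: cL.
  have -> : {for s0, continuous (L^~ y)} =
      (sheet_section Sh i (H (s, y)) @[s --> s0] --> L s0 y).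
    rewrite propeqE; split => h; apply: cvg_trans h; apply: near_eq_cvg;
      near=> s; [|symmetry]; by apply: LE; near: s.
  rewrite LE//.
  apply: (@continuous_comp _ _ _ (fun s => H (s, y)) (sheet_section Sh i)).
    exact: (continuous_comp (@continuous_pairl S I y s0) (cH _)).
  by apply: sheet_section_continuous; exact: NHU.
have bt : ball (sval t : R) e (sval t) by exact: ballxx.
by apply: filterS nt => u bu _; split; apply: step.
Unshelve. all: by end_near. Qed.

End path_lifting.

(** * Homotopy of paths in a simply connected space *)

Section simply_connected.
Context {R : realType} {E : topologicalType}.
Hypothesis scE : simply_connected R E.
Local Notation I := (unit_interval R).

(* A loop [l] first running along [f] and then backwards along [g] bounds a
   square [H] constant on the three other sides. The homotopy is [H] read along
   the segments joining the point of these three sides at parameter [s] to the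
   midpoint of the side carrying [l]. *)
Lemma simply_connected_homotopic (a b : E) (f g : {path I from a to b in E}) :
  path_homotopic f g.
Proof.
have [_ /(_ a) null] := scE.
pose l (t : I) : E := (fun u => if u <= 1/2 then f (clamp (2 * u))
                   else g (clamp (2 - 2 * u))) (sval t).
have cf : continuous (f : I -> E) by exact: cts_fun.
have cg : continuous (g : I -> E) by exact: cts_fun.
have cl : continuous l.
  apply: (continuous_funcomp continuous_uval).
  apply: continuous_paste.
  - apply: (continuous_funcomp _ cf).
    apply: (continuous_funcomp _ continuous_clamp) => u.
    by apply: cvgM; [exact: cvg_cst|exact: cvg_id].
  - apply: (continuous_funcomp _ cg).
    apply: (continuous_funcomp _ continuous_clamp) => u.
    apply: cvgB; first exact: cvg_cst.
    by apply: cvgM; [exact: cvg_cst|exact: cvg_id].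
  - by rewrite !clamp_ge1 ?path_one//; lra.
have l0 : l zero = a.
  by rewrite /l/= ifT ?clamp_le0 ?path_zero//; lra.
have l1 : l one = a.
  have h1 : (1 <= 1/2 :> R) = false by apply/negbTE; rewrite -ltNge; lra.
  by rewrite /l/= h1 clamp_le0 ?path_zero//; lra.
have [H [cH H0 H1 Hz Ho]] := null (mk_path cl l0 l1).
(* On [1/3, 2/3] the value of [p1] is at least 10/9, hence 1 after clamping, while [p2] is 0 before
   and 1 after that interval. The clamped pair thus runs from (0, 0) through (1, 0) and (1, 1) to
   (0, 1). *)
pose p1 (s : R) : R := 5 * (s * (1 - s)).
pose p2 (s : R) : R := sval (clamp (3 * s - 1)).
pose phi (z : I * I) : I * I :=
  (clamp ((1 - sval z.2) * p1 (sval z.1)),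
   clamp ((1 - sval z.2) * p2 (sval z.1) + sval z.2 / 2)).
have cp1 : continuous p1.
  move=> s; apply: cvgM; first exact: cvg_cst.
  by apply: cvgM; [exact: cvg_id|apply: cvgB; [exact: cvg_cst|exact: cvg_id]].
have cp2 : continuous p2.
  apply: (continuous_funcomp _ continuous_uval).
  apply: (continuous_funcomp _ continuous_clamp) => s.
  apply: cvgB; last exact: cvg_cst.
  by apply: cvgM; [exact: cvg_cst|exact: cvg_id].
have cphi : continuous phi.
  have cz1 : continuous (fun z : I * I => sval z.1 : R).
    by apply: (continuous_funcomp _ continuous_uval) => z; exact: cvg_fst.
  have cz2 : continuous (fun z : I * I => sval z.2 : R).
    by apply: (continuous_funcomp _ continuous_uval) => z; exact: cvg_snd.
  have cz3 : continuous (fun z : I * I => 1 - (sval z.2 : R)).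
    by move=> z; apply: cvgB; [exact: cvg_cst|exact: cz2].
  apply: continuous_pair; apply: (continuous_funcomp _ continuous_clamp) => z.
    by apply: cvgM; [exact: cz3|exact: (continuous_funcomp cz1 cp1)].
  apply: cvgD; last by apply: cvgM; [exact: cz2|exact: cvg_cst].
  by apply: cvgM; [exact: cz3|exact: (continuous_funcomp cz1 cp2)].
have p10 : p1 0 = 0 by rewrite /p1 mul0r mulr0.
have p11 : p1 1 = 0 by rewrite /p1 subrr !mulr0.
have p2_le s : s <= 1 / 3 -> clamp (p2 s) = zero.
  by move=> s1; rewrite /p2 clampK clamp_le0//; lra.
have p2_ge s : 2 / 3 <= s -> clamp (p2 s) = one.
  by move=> s1; rewrite /p2 clampK clamp_ge1//; lra.
have p20 : p2 0 = 0 by rewrite /p2 clamp_le0//; lra.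
have p21 : p2 1 = 1 by rewrite /p2 clamp_ge1//; lra.
exists (H \o phi); split.
- exact: (continuous_funcomp cphi cH).
- move=> t; have t01 := uval_itv t.
  rewrite /= /phi/= p10 p20 !mulr0 add0r clamp_le0// H0/=.
  rewrite /mk_path /l clampE ?ifT; [|lra|lra].
  by rewrite mulrC mulfVK// clampK.
- move=> t; have t01 := uval_itv t.
  rewrite /= /phi/= p11 p21 mulr0 mulr1 clamp_le0// H0/=.
  rewrite /mk_path /l clampE; last by lra.
  (* The loop is read at 1 - t/2, which meets the half carrying [f] only for t = 1. *)
  case: ifPn => [t1|_].
    have -> : t = one by apply/val_inj => /=; lra.
    by rewrite clamp_ge1 ?path_one//=; lra.
  have -> : 2 - 2 * (1 - sval t + sval t / 2) = sval t by field.
  by rewrite clampK.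
- move=> s; have s01 := uval_itv s.
  rewrite /= /phi/= subr0 !mul1r mul0r addr0.
  have [s1|s1] := leP (sval s) (1 / 3); first by rewrite p2_le.
  have [s2|s2] := leP (2 / 3) (sval s); first by rewrite p2_ge.
  by rewrite clamp_ge1 ?H1// /p1; nra.
- move=> s; rewrite /= /phi/= subrr !mul0r clamp_le0// add0r H0/=.
  by rewrite /mk_path /l clampE ?ifT ?clamp_ge1 ?path_one//; lra.
Qed.

End simply_connected.

(** * The fundamental group and the fibers *)

Section fundamental_group.
Context {R : realType} {E B : topologicalType} {p : E -> B}.
Hypothesis (covp : covering_map p) (scE : simply_connected R E).
Local Notation I := (unit_interval R).

(** The endpoint of the lift from [e0] reaches the whole fiber because [E] is path connected. It
    determines the class of the loop: a homotopy of loops lifts with constant endpoint, and lifts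
    with a common endpoint are homotopic in [E], so their images are homotopic in [B]. *)
Lemma pi1_fiber_card_eq (x0 : B) :
  (pi1 R x0 #= p @^-1` [set x0])%card.
Proof.
have [cp surjp _] := covp.
have [e0 _ pe0] : range p x0 by rewrite surjp.
pose loop := {path I from x0 to x0 in B}.
have lifts (f : loop) : exists g : I -> E,
    [/\ continuous g, g zero = e0 & forall t, p (g t) = f t].
  by apply: (interval_lift covp); [exact: cts_fun|rewrite pe0 path_zero].
have /choice[L LP] := lifts.
have LE (f : loop) (g : I -> E) : continuous g -> g zero = e0 ->
    (forall t, p (g t) = f t) -> g one = L f one.
  move=> cg g0 pg; have [cL L0 pL] := LP f.
  apply: (lift_unique covp (t0 := zero) connected_unit_interval cg cL).
    by move=> t; rewrite pg pL.
  by rewrite g0 L0.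
have L_surj e : p e = x0 -> exists f : loop, L f one = e.
  move=> pe; have [/(_ e0 e)[g] _] := scE.
  have cg : continuous (p \o g).
    by apply: continuous_funcomp => //; exact: cts_fun.
  have g0 : (p \o g) zero = x0 by rewrite /= path_zero.
  have g1 : (p \o g) one = x0 by rewrite /= path_one.
  exists (mk_path cg g0 g1); rewrite -(LE _ g) ?path_one ?path_zero//.
  exact: cts_fun.
have L_homotopic (f g : loop) : path_homotopic f g <-> L f one = L g one.
  split=> [[H [cH H0 H1 Hz Ho]]|fg].
    have liftH s : exists g : I -> E,
        [/\ continuous g, g zero = e0 & forall t, p (g t) = H (s, t)].
      apply: (interval_lift covp); last by rewrite pe0 Hz.
      exact: (continuous_funcomp (@continuous_pairr I I s) cH).
    have /choice[K KP] := liftH.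
    (* The slices of [H] are lifted independently of one another, yet their endpoints depend
       continuously on s. These endpoints form a path over the constant path at [x0], which is
       constant by uniqueness of lifts. *)
    have cK : continuous (K^~ one).
      apply: (lift_continuous_parameter covp cH).
      - by move=> s; have [] := KP s.
      - by move=> s t; have [] := KP s.
      - have -> : K^~ zero = cst e0 by apply/funext => s; have [] := KP s.
        exact: cst_continuous.
    have [cK0 K00 pK0] := KP zero.
    have [cK1 K10 pK1] := KP one.
    rewrite -(LE f (K zero)) //; last by move=> t; rewrite pK0 H0.
    rewrite -(LE g (K one)) //; last by move=> t; rewrite pK1 H1.
    apply/esym.
    apply: (lift_unique covp (t0 := zero) connected_unit_interval cK
      (@cst_continuous _ _ (K zero one))) => // s.
    have [_ _ ->] := KP s.
    by rewrite pK0 !Ho.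
  have [cf f0 pf] := LP f; have [cg g0 pg] := LP g.
  have [H [cH H0 H1 Hz Ho]] := simply_connected_homotopic scE
    (mk_path cf f0 fg) (mk_path cg g0 erefl).
  exists (p \o H); split => /=.
  - exact: (continuous_funcomp cH cp).
  - by move=> t; rewrite H0 -pf.
  - by move=> t; rewrite H1 -pg.
  - by move=> s; rewrite Hz.
  - by move=> s; rewrite Ho pg path_one.
(* The inverse bijection, from points of the fiber to homotopy classes. *)
pose class (e : E) : set loop := [set g | e = L g one].
have -> : pi1 R x0 = class @` (p @^-1` [set x0]).
  apply/seteqP; split => c [].
  - move=> f _ <-; exists (L f one).
      by have [_ _ pL] := LP f; rewrite /preimage/= pL path_one.
    by apply/seteqP; split => g /L_homotopic.
  - move=> e /L_surj[f <-] <-; exists f => //.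
    by apply/seteqP; split => g /L_homotopic.
apply: inj_card_eq => e e'; rewrite !inE => /L_surj[f fe] _ ee'.
have : class e f by rewrite /class/= fe.
by rewrite ee' /class/= fe.
Qed.

End fundamental_group.

(** * Enumerations of the fibers *)

Lemma finite_set_enum (T : choiceType) (A : set T) : finite_set A ->
  exists z : 'I_#|` fset_set A| -> T, injective z /\ range z = A.
Proof.
move=> finA; exists (tnth (in_tuple (fset_set A))); split.
  by apply/tuple_uniqP; exact: fset_uniq.
apply/seteqP; split => [_ [i _ <-]|x Ax].
  by have := mem_tnth i (in_tuple (fset_set A)); rewrite /= in_fset_set// inE.
have : x \in in_tuple (fset_set A) by rewrite /= in_fset_set// inE.
by move=> /tnthP[i ->]; exists i.
Qed.

(* The sheet through each point of one fiber turns an enumeration of that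
   fiber into continuous enumerations of the fibers nearby. *)
Lemma fiber_enum_extend (E B : topologicalType) (p : E -> B) (U : set B)
    (S : sheets p U) (n : nat) (b : B) (z : 'I_n -> E) :
  U b -> injective z -> range z = p @^-1` [set b] ->
  exists Z : 'I_n -> B -> E,
    (forall k b', U b' -> {for b', continuous (Z k)}) /\
    (forall b', U b' -> injective (Z^~ b') /\ range (Z^~ b') = p @^-1` [set b']).
Proof.
move=> Ub injz rz.
have pz k : p (z k) = b.
  by have : range z (z k) by []; rewrite rz.
have /choice[i Vi] : forall k, exists i, sheet S i (z k).
  by move=> k; apply: sheet_cover; rewrite pz.
exists (fun k => sheet_section S (i k)); split.
  by move=> k b' Ub'; exact: sheet_section_continuous.
move=> b' Ub'; split.
- move=> k l kl; apply: injz.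
  have ikl : i k = i l.
    apply: (sheet_inj (sheet_section_in S (i k) Ub')).
    by rewrite kl; exact: sheet_section_in.
  by rewrite -(sheetK (Vi k)) -(sheetK (Vi l)) !pz ikl.
- apply/seteqP; split => [_ [k _ <-]|e pe]; first exact: sheet_sectionK.
  have [j Vj] : exists j, sheet S j e by apply: sheet_cover; rewrite pe.
  (* Every sheet meets the fiber over [b], so the sheet of [e] contains some [z k]. *)
  have : (p @^-1` [set b]) (sheet_section S j b) by exact: sheet_sectionK.
  rewrite -rz => -[k _ zk]; exists k => //.
  have -> : i k = j.
    by apply: (sheet_inj (Vi k)); rewrite zk; exact: sheet_section_in.
  by rewrite -pe sheetK.
Qed.

(** Over an evenly covered set an enumeration passes from any fiber to any other, in both
    directions, so having exactly n points is a locally constant property of the fiber. *)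
Lemma covering_fiber_enum (E B : topologicalType) (p : E -> B) (n : nat)
    (b0 : B) (z0 : 'I_n -> E) : covering_map p -> connected [set: B] ->
  injective z0 -> range z0 = p @^-1` [set b0] ->
  forall b, exists z : 'I_n -> E, injective z /\ range z = p @^-1` [set b].
Proof.
move=> covp cB inj0 r0 b.
apply: (@connected_locally_constant B setT (fun b => exists z : 'I_n -> E,
  injective z /\ range z = p @^-1` [set b]) cB _ b0) => //; last by exists z0.
move=> {}b _; have [U [oU Ub [S]]] := covering_sheets b covp.
have : \forall b' \near b, U b' by apply: open_nbhs_nbhs.
apply: filterS => b' Ub' _; split=> -[z [injz rz]].
- have [Z [_ ZP]] := fiber_enum_extend S Ub' injz rz.
  by exists (Z^~ b); exact: ZP.
- have [Z [_ ZP]] := fiber_enum_extend S Ub injz rz.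
  by exists (Z^~ b'); exact: ZP.
Qed.

(** * Uniform measures on the fibers *)

Section uniform_measure.
Context {R : realType} {Z : ptopologicalType} (n : nat) (z : 'I_n.+1 -> Z).

(** Built from [mscale] and [msum] to inherit their measure structure; [msum] takes a sequence
    indexed by natural numbers, hence [inord]. *)
Definition uniform_measure : set (borel Z) -> \bar R :=
  mscale (n.+1%:R^-1)%:nng
    (msum (fun k : nat => dirac (z (inord k) : borel Z)) n.+1).

HB.instance Definition _ := Measure.on uniform_measure.

Lemma uniform_measureE (A : set Z) : uniform_measure A =
  (\sum_(i < n.+1) (n.+1%:R^-1)%:E * \d_(z i : borel Z) A)%E.
Proof.
rewrite /uniform_measure /mscale/= /msum ge0_sume_distrr//.
by apply: eq_bigr => i _; rewrite inord_val.
Qed.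

Lemma sum_uniform_weights : \sum_(i < n.+1) (n.+1%:R^-1 : R) = 1.
Proof. by rewrite sumr_const card_ord -[LHS]mulr_natr mulVf. Qed.

Lemma uniform_measure_setT : uniform_measure setT = 1%E.
Proof.
rewrite uniform_measureE -[in RHS]sum_uniform_weights -sumEFin.
by apply: eq_bigr => i _; rewrite diracT mule1.
Qed.

HB.instance Definition _ :=
  Measure_isProbability.Build _ _ _ uniform_measure uniform_measure_setT.

Definition uniform_prob : borel_prob R Z := uniform_measure.

Lemma uniform_prob_sum :
  is_sum_of_diracs uniform_prob (fun=> n.+1%:R^-1) z.
Proof. exact: uniform_measureE. Qed.

Lemma ge0_integral_uniform (g : borel Z -> R) : measurable_fun setT g ->
  (forall x, 0 <= g x) ->
  (\int[uniform_measure]_x (g x)%:E = (n.+1%:R^-1 * \sum_i g (z i))%:E)%E.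
Proof.
move=> mg g0; have mEg : measurable_fun [set: borel Z] (fun x => (g x)%:E).
  exact/measurable_EFinP.
rewrite ge0_integral_mscale//=; last by move=> x _; rewrite lee_fin.
rewrite ge0_integral_measure_sum//; last by move=> x _; rewrite lee_fin.
rewrite EFinM -sumEFin; congr (_ * _)%E; apply: eq_bigr => i _.
by rewrite integral_dirac// diracT mul1e inord_val.
Qed.

Lemma continuous_borel_measurable (f : Z -> R) : continuous f ->
  measurable_fun setT (f : borel Z -> R).
Proof.
move=> /continuousP cf; apply: (measurability _ (RGenOpens.measurableE R)).
move=> _ [_ [a [b ->] <-]]; rewrite setTI.
apply: sub_sigma_algebra; apply: cf; exact: interval_open.
Qed.

Lemma Rintegral_uniform (f : Z -> R) : continuous f ->
  Rintegral uniform_prob setT f = n.+1%:R^-1 * \sum_i f (z i).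
Proof.
move=> cf; have mf := continuous_borel_measurable cf.
rewrite /Rintegral integralE (_ : (fun x => (f x)%:E) = EFin \o f)//.
rewrite funerpos funerneg.
rewrite !ge0_integral_uniform//.
- rewrite -EFinB/= -mulrBr -sumrB; congr (_ * _); apply: eq_bigr => i _.
  by rewrite -[in RHS](funrposBneg f).
- exact: measurable_funrneg.
- exact: measurable_funrpos.
Qed.

(** The complement of the range is an open null set, while every neighbourhood of some [z i] has
    mass at least 1/(n+1). *)
Lemma supp_uniform : closed (range z) -> supp uniform_prob = range z.
Proof.
move=> clz; apply/seteqP; split => [x suppx|_ [i _ <-] U oU Ui].
  apply: contrapT => nx; have := suppx (~` range z) (closed_openC clz) nx.
  rewrite uniform_prob_sum big1 ?ltxx// => i _.
  by rewrite diracE memNset ?mule0// => /(_ (imageT _ _)).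
rewrite uniform_prob_sum (bigD1 i)//= diracE mem_set// mule1.
apply: (@lt_le_trans _ _ (n.+1%:R^-1)%:E); first by rewrite lte_fin invr_gt0.
by rewrite leeDl// sume_ge0// => j _; rewrite mule_ge0// lee_fin invr_ge0.
Qed.

End uniform_measure.

(** * Continuity of the uniform measures on the fibers *)

Lemma perm_eq_codom (T : eqType) (n : nat) (z w : 'I_n -> T) :
  injective z -> injective w -> range z = range w ->
  perm_eq (codom z) (codom w).
Proof.
move=> iz iw zw.
have sub (u v : 'I_n -> T) :
    range u = range v -> {subset codom u <= codom v}.
  move=> uv _ /codomP[i ->]; have : range u (u i) by exists i.
  by rewrite uv => -[j _ <-]; exact: codom_f.
apply: uniq_perm; [exact/injectiveP|exact/injectiveP|] => x.
by apply/idP/idP; apply: sub.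
Qed.

(** Makes the average of a function over a fiber independent of the enumeration. *)
Lemma sum_range_eq (T : choiceType) (V : nmodType) (n : nat) (z w : 'I_n -> T)
    (f : T -> V) : injective z -> injective w -> range z = range w ->
  \sum_i f (z i) = \sum_i f (w i).
Proof.
move=> iz iw zw.
have sumE (u : 'I_n -> T) : \sum_i f (u i) = \sum_(x <- codom u) f x.
  by rewrite big_image.
by rewrite !sumE; apply: perm_big; exact: perm_eq_codom.
Qed.

Lemma continuous_ptws (T : topologicalType) (I : Type) (V : topologicalType)
    (f : T -> {ptws I -> V}) :
  (forall i, continuous (fun t => f t i)) -> continuous f.
Proof.
move=> cf t; apply/cvg_sup => i U [/= _ [[W oW <-] Wft]] /filterS; apply.
by apply: cf; exact: open_nbhs_nbhs.
Qed.

(** The enumerations [z b] are chosen point by point, with no continuity in [b]. Near a given point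
    they are exchanged for the continuous ones of [fiber_enum_extend], which leaves the average of
    each test function unchanged. *)
Lemma uniform_prob_continuous (R : realType) (E : ptopologicalType)
    (B : topologicalType) (p : E -> B) (n : nat) (z : B -> 'I_n.+1 -> E) :
  covering_map p ->
  (forall b, injective (z b) /\ range (z b) = p @^-1` [set b]) ->
  continuous (fun b => uniform_prob (z b) : borel_prob R E).
Proof.
move=> covp zP; apply: continuous_comp_initial.
apply: continuous_ptws => -[f [cf bf]] b.
have [U [oU Ub [S]]] := covering_sheets b covp.
have [injz rz] := zP b.
have [G [cG GP]] := fiber_enum_extend S Ub injz rz.
pose h b' := Rintegral (uniform_prob (z b') : borel_prob R E) setT f.
have hE b' : U b' -> h b' = n.+1%:R^-1 * \sum_i f (G i b').
  move=> Ub'; rewrite /h Rintegral_uniform//; congr (_ * _).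
  have [injz' rz'] := zP b'; have [injG rG] := GP _ Ub'.
  by apply: sum_range_eq => //; rewrite rz' rG.
suff : {for b, continuous h} by [].
rewrite /prop_for /continuous_at hE//.
apply: (@cvg_trans _ (n.+1%:R^-1 * \sum_i f (G i b') @[b' --> b])).
  apply: near_eq_cvg; have : \forall b' \near b, U b' by exact: open_nbhs_nbhs.
  by apply: filterS => b' Ub'; rewrite hE.
apply: cvgM; first exact: cvg_cst.
apply: cvg_big => [|i _]; first exact: add_continuous.
by apply: continuous_cvg; [exact: cf|exact: cG].
Qed.

(** * The section and the bound *)

Lemma dcat1_le (R : realType) (E : ptopologicalType) (X : topologicalType)
    (q : E -> X) (n : nat) :
  has_section (@fiberwise_proj R E X q n.+1) -> (dcat1 R q <= n%:R%:E)%E.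
Proof.
move=> sec; rewrite /dcat1; case: pselect => [ex|]; last first.
  by case; exists n; apply/asboolP.
by rewrite lee_fin ler_nat; case: ex_minnP => m _; apply; apply/asboolP.
Qed.

Unset Implicit Arguments.
Set Strict Implicit.
Set Printing Implicit Defensive.

Theorem corollary5p2 (R : realType) (X : topologicalType)
    (cwX : CW_complex R X) (connX : connected [set: X])
    (x0 : X) (finpi : finite_set (pi1 R x0))
    (Xt : ptopologicalType) (q : Xt -> X) (univ : universal_covering R q) :
  (dcat1 R q <= (pi1_order R x0).-1%:R%:E)%E /\
  exists tau : X -> fiberwise_prob R q (pi1_order R x0),
    [/\ continuous tau,
        forall x, fiberwise_proj (tau x) = x &
        forall x, exists z : 'I_(pi1_order R x0) -> Xt,
          [/\ injective z, range z = q @^-1` [set x] &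
              is_sum_of_diracs (set_val (tau x))
                (fun=> (pi1_order R x0)%:R^-1) z]].
Proof.
have [covq scE] := univ; have [cq surjq _] := covq.
have pi1_fiber := pi1_fiber_card_eq covq scE x0.
(* [fset_set] is faithful only on finite sets, so finiteness is transported to the fiber before
   cardinals are compared. *)
have finF : finite_set (q @^-1` [set x0]) by rewrite -(eq_finite_set pi1_fiber).
have orderE : pi1_order R x0 = #|` fset_set (q @^-1` [set x0])|%fset.
  exact/fcard_eq.
have [z0 [injz0 rz0]] := finite_set_enum finF.
move: z0 injz0 rz0; rewrite -orderE.
(* The fiber is nonempty, so the order is a successor and the predecessor in the bound is not
   truncated. *)
have : (0 < pi1_order R x0)%N.
  rewrite orderE cardfs_gt0; apply/fset0Pn.
  have [e0 _ qe0] : range q x0 by rewrite surjq.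
  by exists e0; rewrite in_fset_set// inE.
case: (pi1_order R x0) => // n _ z0 injz0 rz0 /=.
have /choice[z zP] := covering_fiber_enum covq connX injz0 rz0.
have clF x : closed (q @^-1` [set x]).
  apply: preimage_closed; first by move=> y _; exact: cq.
  exact/accessible_closed_set1/hausdorff_accessible/(CW_hausdorff cwX).
have suppE x : supp (uniform_prob (z x) : borel_prob R Xt) = q @^-1` [set x].
  by rewrite supp_uniform (zP x).2.
have mem x : fiberwise_prob R q n.+1 (uniform_prob (z x)).
  split; last by exists x; rewrite suppE.
  exists (fun=> n.+1%:R^-1), (z x); split; last exact: uniform_prob_sum.
    by move=> _; rewrite invr_ge0.
  exact: sum_uniform_weights.
pose tau x : fiberwise_prob R q n.+1 := SigSub (mem_set (mem x)).
have ctau : continuous tau.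
  apply: continuous_comp_initial.
  exact: (uniform_prob_continuous covq zP).
have proj_tau x : fiberwise_proj (tau x) = x.
  (* The base point [b] comes from a choice; as the support is the whole nonempty fiber over [x], it
     can only be [x]. *)
  rewrite /fiberwise_proj; case: cid => /= b; rewrite suppE => sub.
  have [e _ qe] : range q x by rewrite surjq.
  by rewrite -qe; apply/esym/sub.
split; first by apply: dcat1_le; exists tau.
exists tau; split => // x; exists (z x); have [injz rz] := zP x.
by split => //; exact: uniform_prob_sum.
Qed.
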